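(* Let $P$ be a finite-dimensional symplectic manifold with a free, proper, symplectic action of a Lie group $G$ with Lie algebra $\mathfrak g$ and an equivariant momentum map $J\colon P\to\mathfrak g^*$. Let $H$ be a $G$-invariant Hamiltonian on $P$ and let $p_e$ be a relative equilibrium with $\mu_e=J(p_e)$. If $p_e$ is $G$-stable and there exists a $G^{\rm o}_{\mu_e}$-invariant inner product on $\mathfrak g^*$, then $p_e$ is $G^{\rm o}_{\mu_e}$-stable.
   Context: $J(gp)=\mathrm{Ad}^*_{g^{-1}}J(p)$. $G_{\mu_e}$ is the isotropy subgroup of $\mu_e$ for the coadjoint action and $G_{\mu_e}^{\rm o}$ its identity component. Invariance of the inner product on $\mathfrak g^*$ is with respect to the coadjoint action. $X_H$ is the Hamiltonian vector field and $\Phi_t$ its $G$-equivariant flow. $p_e$ is a relative equilibrium if $X_H(p_e)=\xi_ep_e$ (infinitesimal action) for some $\xi_e\in\mathfrak g$. It is $G$-stable if for every $G$-invariant neighbourhood $U$ of $p_e$ there is a neighbourhood $V$ of $p_e$ such that $\Phi_t(p)\in U$ for all $p\in V$ and all $t$. For a subset $A\subseteq G$, $p_e$ is $A$-stable if for every open neighbourhood $U\subseteq P$ of $p_e$ there is an open neighbourhood $U'\subseteq P$ of $p_e$ such that $p\in U'$ implies $\Phi_t(p)\in AU$ for all $t\in\mathbb R$. *)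

(* Defs.v *)
From HB Require Import structures.
From mathcomp Require Import all_boot all_order all_algebra.
From mathcomp Require Import sesquilinear.
From mathcomp Require Import all_classical all_reals all_analysis.

Set Implicit Arguments.
Unset Strict Implicit.
Unset Printing Implicit Defensive.

Import Order.TTheory GRing.Theory Num.Theory.
Import numFieldNormedType.Exports.

Local Open Scope classical_set_scope.
Local Open Scope ring_scope.

Section SmoothOn.
Context {R : realType} {V W : normedModType R}.

(* For V finite-dimensional and U open this is the usual class C^k(U, W): the
   (k+1)-st step asks for differentiability on U and for all directional
   derivatives x |-> Df(x) v to be C^k. *)
Fixpoint Ck_on (k : nat) (U : set V) (f : V -> W) : Prop :=
  match k with
  | 0%N => forall x, U x -> {for x, continuous f}
  | k'.+1 => (forall x, U x -> differentiable f x) /\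
             forall v, Ck_on k' U (fun x => 'd f x v)
  end.

Definition smooth_on (U : set V) (f : V -> W) : Prop := forall k, Ck_on k U f.

End SmoothOn.

(* [chart_map] and [chart_inv] are total functions; only their restrictions
   to [chart_dom] and [chart_img], which are mutually inverse homeomorphisms,
   are meaningful. *)
Record chart (R : realType) (n : nat) (M : topologicalType) := Chart {
  chart_dom : set M;
  chart_map :> M -> 'rV[R]_n;
  chart_inv : 'rV[R]_n -> M;
  chart_dom_open : open chart_dom;
  chart_img_open : open (chart_map @` chart_dom);
  chart_mapK : forall x, chart_dom x -> chart_inv (chart_map x) = x;
  chart_map_continuous : forall x, chart_dom x -> {for x, continuous chart_map};
  chart_inv_continuous :
    forall y, (chart_map @` chart_dom) y -> {for y, continuous chart_inv} }.

Definition chart_img (R : realType) (n : nat) (M : topologicalType)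
  (c : chart R n M) : set 'rV[R]_n := c @` chart_dom c.

(* Besides the atlas, each point x has a
   preferred chart [chart_at x]; it only serves to name tangent vectors: the
   tangent space T_x M is identified with 'rV[R]_n through [chart_at x]. *)
HB.mixin Record isManifold (R : realType) (n : nat) M of Topological M := {
  atlas : set (chart R n M);
  chart_at : M -> chart R n M;
  chart_at_atlas : forall x, atlas (chart_at x);
  chart_at_dom : forall x, chart_dom (chart_at x) x;
  atlas_compatible : forall c d : chart R n M, atlas c -> atlas d ->
    smooth_on (c @` (chart_dom c `&` chart_dom d)) (d \o chart_inv c);
  manifold_hausdorff : hausdorff_space M;
  manifold_second_countable : @second_countable M }.

#[short(type="manifoldType")]
HB.structure Definition Manifold (R : realType) (n : nat) :=
  { M of isManifold R n M & Topological M }.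

Section SmoothMaps.
Context {R : realType}.

Definition smooth_map m n (M : manifoldType R m) (N : manifoldType R n)
    (f : M -> N) : Prop :=
  continuous f /\
  forall (c : chart R m M) (d : chart R n N), atlas c -> atlas d ->
    smooth_on (c @` (chart_dom c `&` f @^-1` chart_dom d))
              (d \o f \o chart_inv c).

(* Smoothness of M1 * M2 -> N for the product manifold structure, whose
   charts are the products of charts of M1 and of M2. *)
Definition smooth_map2 m1 m2 n (M1 : manifoldType R m1)
    (M2 : manifoldType R m2) (N : manifoldType R n) (f : M1 -> M2 -> N) : Prop :=
  continuous (fun z : M1 * M2 => f z.1 z.2) /\
  forall (c1 : chart R m1 M1) (c2 : chart R m2 M2) (d : chart R n N),
    atlas c1 -> atlas c2 -> atlas d ->
    smooth_on
      [set y : 'rV[R]_m1 * 'rV[R]_m2 | [/\ chart_img c1 y.1, chart_img c2 y.2 &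
         chart_dom d (f (chart_inv c1 y.1) (chart_inv c2 y.2))]]
      (fun y => d (f (chart_inv c1 y.1) (chart_inv c2 y.2))).

Definition smooth_fun m (M : manifoldType R m) (W : normedModType R)
    (f : M -> W) : Prop :=
  forall c : chart R m M, atlas c ->
    smooth_on (chart_img c) (f \o chart_inv c).

(* T_x M -> T_(f x) N, in the preferred charts of x and f x. *)
Definition mderiv m n (M : manifoldType R m) (N : manifoldType R n)
    (f : M -> N) (x : M) : 'rV[R]_m -> 'rV[R]_n :=
  'd (chart_at (f x) \o f \o chart_inv (chart_at x)) (chart_at x x).

Definition mdiff m (M : manifoldType R m) (W : normedModType R)
    (f : M -> W) (x : M) : 'rV[R]_m -> W :=
  'd (f \o chart_inv (chart_at x)) (chart_at x x).

(* For y in the image of c, the isomorphism 'rV_m -> T_x M at the point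
   x = c^-1(y) given by the coordinate frame of c. *)
Definition frame m (M : manifoldType R m) (c : chart R m M) (y : 'rV[R]_m) :
    'rV[R]_m -> 'rV[R]_m :=
  'd (chart_at (chart_inv c y) \o chart_inv c) y.

(* c is an integral curve of the vector field X on I. The continuity clause is
   needed because [chart_at (c t)] is only meaningful on its domain. *)
Definition integral_curve_on m (M : manifoldType R m) (X : M -> 'rV[R]_m)
    (I : set R) (c : R -> M) : Prop :=
  forall t, I t -> {for t, continuous c} /\
    is_derive t (1 : R) (chart_at (c t) \o c) (X (c t)).

(* The maximal flow of X: Phi t p is meaningful for t in the open interval
   D p, the domain of the maximal integral curve through p. *)
Definition maximal_flow m (M : manifoldType R m) (X : M -> 'rV[R]_m)
    (D : M -> set R) (Phi : R -> M -> M) : Prop :=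
  forall p, [/\ open (D p), is_interval (D p) & D p 0] /\
    [/\ Phi 0 p = p, integral_curve_on X (D p) (Phi ^~ p) &
    forall (I : set R) (c : R -> M), open I -> is_interval I -> I 0 ->
      c 0 = p -> integral_curve_on X I c -> I `<=` D p].

End SmoothMaps.

Section Symplectic.
Context {R : realType} {n : nat} {P : manifoldType R n}.

(* A (pointwise) 2-form assigns to each x a skew-symmetric form on T_x P. *)
Implicit Type omega : P -> {skew_symmetric 'rV[R]_n}.

Definition form_in_chart omega (c : chart R n P) (u v y : 'rV[R]_n) : R :=
  omega (chart_inv c y) (frame c y u) (frame c y v).

Definition smooth_form omega : Prop :=
  forall c : chart R n P, atlas c ->
    forall u v, smooth_on (chart_img c) (form_in_chart omega c u v).

(* d omega = 0, evaluated in charts on constant vector fields u, v, w. *)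
Definition closed_form omega : Prop :=
  forall c : chart R n P, atlas c ->
    forall (u v w y : 'rV[R]_n), chart_img c y ->
      'D_u (form_in_chart omega c v w) y + 'D_v (form_in_chart omega c w u) y
      + 'D_w (form_in_chart omega c u v) y = 0.

Definition nondegenerate_form omega : Prop :=
  forall x u, (forall v, omega x u v = 0) -> u = 0.

Definition symplectic_form omega : Prop :=
  [/\ smooth_form omega, closed_form omega & nondegenerate_form omega].

Definition hamiltonian_vector_field omega (H : P -> R) (X : P -> 'rV[R]_n) :
    Prop :=
  forall x v, omega x (X x) v = mdiff H x v.

End Symplectic.

HB.mixin Record isLieGroup (R : realType) (m : nat) G
    of Manifold R m G & Group G := {
  lie_mul_smooth : smooth_map2 (fun g h : G => (g * h)%g);
  lie_inv_smooth : smooth_map (fun g : G => (g^-1)%g) }.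

#[short(type="lieGroupType")]
HB.structure Definition LieGroup (R : realType) (m : nat) :=
  { G of isLieGroup R m G & Manifold R m G & Group G }.

Section LieGroupTheory.
Context {R : realType} {m : nat} {G : lieGroupType R m}.

(* The Lie algebra is T_1 G = 'rV[R]_m and its dual is 'cV[R]_m. *)
Definition pairing (mu : 'cV[R]_m) (xi : 'rV[R]_m) : R := (xi *m mu) 0 0.

Definition Ad (g : G) : 'rV[R]_m -> 'rV[R]_m :=
  mderiv (fun h : G => (g * h * g^-1)%g) 1%g.

(* The transpose of Ad g, see [pairing_Ad_dual]. *)
Definition Ad_dual (g : G) (mu : 'cV[R]_m) : 'cV[R]_m := lin1_mx (Ad g) *m mu.

Lemma pairing_Ad_dual (g : G) mu xi :
  pairing (Ad_dual g mu) xi = pairing mu (Ad g xi).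
Proof. by rewrite /pairing /Ad_dual mulmxA mul_rV_lin1. Qed.

Definition coadjoint (g : G) (mu : 'cV[R]_m) : 'cV[R]_m := Ad_dual (g^-1)%g mu.

Definition isotropy (mu : 'cV[R]_m) : set G := [set g | coadjoint g mu = mu].

Definition isotropy0 (mu : 'cV[R]_m) : set G :=
  connected_component (isotropy mu) 1%g.

(* {dot _ for idfun} is the type of symmetric positive definite forms. *)
Definition invariant_inner_product (A : set G)
    (B : {dot 'cV[R]_m for (@idfun R)}) : Prop :=
  forall g, A g -> forall mu nu, B (coadjoint g mu) (coadjoint g nu) = B mu nu.

End LieGroupTheory.

Section Actions.
Context {R : realType} {m n : nat}.
Context {G : lieGroupType R m} {P : manifoldType R n}.
Implicit Type act : G -> P -> P.
Implicit Type omega : P -> {skew_symmetric 'rV[R]_n}.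

Definition smooth_action act : Prop :=
  [/\ forall p, act 1%g p = p,
      forall g h p, act (g * h)%g p = act g (act h p) &
      smooth_map2 act].

Definition free_action act : Prop := forall g p, act g p = p -> g = 1%g.

Definition proper_action act : Prop :=
  forall K : set (P * P), compact K ->
    compact [set z : G * P | K (act z.1 z.2, z.2)].

Definition symplectic_action omega act : Prop :=
  forall g x u v, omega (act g x) (mderiv (act g) x u) (mderiv (act g) x v)
                  = omega x u v.

Definition infinitesimal_action act (xi : 'rV[R]_m) (p : P) : 'rV[R]_n :=
  mderiv (fun g : G => act g p) 1%g xi.

Definition momentum_map omega act (J : P -> 'cV[R]_m) : Prop :=
  smooth_fun J /\
  forall xi, hamiltonian_vector_field omega (fun p => pairing (J p) xi)
               (infinitesimal_action act xi).

Definition equivariant_momentum act (J : P -> 'cV[R]_m) : Prop :=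
  forall g p, J (act g p) = coadjoint g (J p).

Definition relative_equilibrium act (X : P -> 'rV[R]_n) (pe : P) : Prop :=
  exists xi : 'rV[R]_m, X pe = infinitesimal_action act xi pe.

(* In both notions of stability, "Phi_t(p) belongs to ... for all t" includes
   that the trajectory of p is defined for all times. *)
Definition G_stable act (D : P -> set R) (Phi : R -> P -> P) (pe : P) : Prop :=
  forall U : set P, nbhs pe U -> (forall g p, U p -> U (act g p)) ->
    exists2 V : set P, nbhs pe V &
      forall p, V p -> forall t : R, D p t /\ U (Phi t p).

Definition subset_stable act (A : set G) (D : P -> set R) (Phi : R -> P -> P)
    (pe : P) : Prop :=
  forall U : set P, open U -> U pe ->
    exists U' : set P, [/\ open U', U' pe &
      forall p, U' p -> forall t : R,
        D p t /\ [set act g q | g in A & q in U] (Phi t p)].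

End Actions.

(* Main.v *)
(* Noether's theorem keeps J(Phi_t p) constant. By G-stability the trajectory
   stays in G U0 for a small neighbourhood U0 of pe, so Phi_t p = g(t) u(t) with
   u(t) in U0 and g(t) moving mu_e = J(pe) only slightly, as measured by
   f(q) = |J(q) - mu_e|^2. Let F be the isotropy group of mu_e and L its identity
   component. As the norm is L-invariant, so is f, and hence all estimates on g
   take place modulo L.

   That F be a Lie subgroup is not needed: since L is the component of 1 in F and
   G is locally compact, there are arbitrarily thin open sets Q containing L with
   L Q = Q whose boundary avoids F (in a compact Hausdorff space components are
   quasi-components, here applied modulo L). On the boundary of Q, compact modulo
   L, f is bounded away from f(pe), and the action being free and proper, g(t) is
   determined up to a small error by Phi_t p. So the times at which Phi_t p lies in
   Q U0 and those at which it lies in (G \ Q) U0 form a partition of the real line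
   into two open sets, and the second one is empty. *)
Require Import Defs.
From HB Require Import structures.
From mathcomp Require Import all_boot all_order all_algebra.
From mathcomp Require Import sesquilinear.
From mathcomp Require Import all_classical all_reals all_analysis.
Import Order.TTheory GRing.Theory Num.Theory.
Import numFieldNormedType.Exports.
Local Open Scope classical_set_scope.
Local Open Scope ring_scope.

Set Implicit Arguments.
Unset Strict Implicit.
Unset Printing Implicit Defensive.

(** * Local compactness of manifolds; continuity and components in Lie groups *)

Lemma manifold_locally_compact (R : realType) (n : nat) (M : manifoldType R n)
    (x : M) : exists2 C : set M, nbhs x C & compact C.
Proof.
pose c : chart R n M := chart_at x.
have dx : chart_dom c x := chart_at_dom x.
have : nbhs (c x) (chart_img c).
  by apply: open_nbhs_nbhs; split; [exact: chart_img_open|exists x].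
move=> /nbhs_closedballP[r rU].
exists (chart_inv c @` closed_ball (c x) r%:num).
  have dn : nbhs x (chart_dom c).
    by apply: open_nbhs_nbhs; split => //; exact: chart_dom_open.
  have cn : nbhs x (c @^-1` closed_ball (c x) r%:num).
    apply: (chart_map_continuous dx).
    by apply/nbhs_closedballP; exists r.
  apply: filterS2 dn cn => z dz cz.
  by exists (c z) => //; exact: chart_mapK.
apply: continuous_compact.
  apply: continuous_in_subspaceT => y /set_mem /rU.
  exact: chart_inv_continuous.
apply: bounded_closed_compact; last exact: closed_ball_closed.
exists (`|c x| + r%:num); split; first exact: num_real.
move=> e lte y; rewrite closed_ballE// /closed_ball_ /= => yr.
apply: le_trans (ltW lte); rewrite -[y](subKr (c x)).
by apply: le_trans (ler_normB _ _) _; rewrite lerD2l.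
Qed.

Section TopologicalGroup.
Context {R : realType} {m : nat} {G : lieGroupType R m}.
Implicit Types (g h l a b : G) (A N : set G).

Lemma lie_mul_continuous : continuous (fun z : G * G => (z.1 * z.2)%g).
Proof. by have [] := @lie_mul_smooth R m G. Qed.

Lemma lie_inv_continuous : continuous (fun g : G => (g^-1)%g).
Proof. by have [] := @lie_inv_smooth R m G. Qed.

Section Composition.
Context {T : topologicalType}.

Lemma mulg_continuous_at (u v : T -> G) (x : T) :
  {for x, continuous u} -> {for x, continuous v} ->
  {for x, continuous (fun y => u y * v y)%g}.
Proof.
move=> cu cv; apply: continuous2_cvg => //.
exact: (@lie_mul_continuous (u x, v x)).
Qed.

Lemma invg_continuous_at (u : T -> G) (x : T) :
  {for x, continuous u} -> {for x, continuous (fun y => (u y)^-1)%g}.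
Proof. by move=> cu; exact: (continuous_comp cu (@lie_inv_continuous _)). Qed.

End Composition.

Lemma mulg_continuousl g : continuous (fun h : G => (g * h)%g).
Proof.
by move=> h; apply: mulg_continuous_at; [exact: cst_continuous|move=> ?; exact: cvg_id].
Qed.

(** The set is the product A N, a union of left translates of N; in this form membership yields the
    factor in A directly. *)
Lemma open_right_translates A N : open N ->
  open [set g | exists2 a, A a & N (a^-1 * g)%g].
Proof.
move=> oN; rewrite openE => g [a Aa Nag].
have nN : nbhs (a^-1 * g)%g N by exact: open_nbhs_nbhs.
have : \forall h \near g, N (a^-1 * h)%g.
  exact: (@mulg_continuousl _ g).
by apply: filterS => h Nh; exists a.
Qed.

Lemma connected_left_translate g A : connected A ->
  connected [set (g * a)%g | a in A].
Proof.
move=> cA; apply: connected_continuous_connected => //.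
exact/continuous_subspaceT/mulg_continuousl.
Qed.

Section IdentityComponent.
Context (F : set G).
Hypotheses (F1 : F 1%g) (FM : forall g h, F g -> F h -> F (g * h)%g)
  (FV : forall g, F g -> F (g^-1)%g).
Let L : set G := connected_component F 1%g.

Lemma identity_component1 : L 1%g.
Proof. exact: connected_component_refl. Qed.

(** The translate of L by l^-1 is connected, lies in F and contains 1 = l^-1 l. Stability under
    inverses and under products both follow from this combination. *)
Lemma identity_componentVM l h : L l -> L h -> L (l^-1 * h)%g.
Proof.
move=> Ll Lh.
suff : [set (l^-1 * a)%g | a in L] `<=` L by apply; exists h.
apply: connected_component_max.
- by exists l => //; rewrite mulVg.
- move=> _ [a La <-]; apply: FM.
  by apply: FV; exact: connected_component_sub Ll.
  exact: connected_component_sub La.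
- exact/connected_left_translate/component_connected.
Qed.

Lemma identity_componentV l : L l -> L (l^-1)%g.
Proof.
move=> Ll; rewrite -[(l^-1)%g]mulg1.
by apply: identity_componentVM => //; exact: identity_component1.
Qed.

Lemma identity_componentM l h : L l -> L h -> L (l * h)%g.
Proof.
move=> Ll Lh; rewrite -[l]invgK.
by apply: identity_componentVM => //; exact: identity_componentV.
Qed.

End IdentityComponent.

End TopologicalGroup.

(** * Isolating the identity component of a closed subgroup *)

Section QuasiComponent.
Context {R : realType} {m : nat} {G : lieGroupType R m}.
Context (F : set G).
Hypotheses (clF : closed F) (F1 : F 1%g)
  (FM : forall g h, F g -> F h -> F (g * h)%g)
  (FV : forall g, F g -> F (g^-1)%g).
Let L : set G := connected_component F 1%g.

Let L1 : L 1%g := identity_component1 F1.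
Let LV l : L l -> L (l^-1)%g.
Proof. exact: identity_componentV. Qed.
Let LM l h : L l -> L h -> L (l * h)%g.
Proof. exact: identity_componentM. Qed.
Let LF l : L l -> F l.
Proof. exact: connected_component_sub. Qed.

Section Saturation.
Context (C0 : set G).
Hypotheses (C0n : nbhs 1%g C0) (C0c : compact C0).

Let K : set G := [set g | exists2 l, L l & C0 (l^-1 * g)%g].

Let saturated (Q : set G) := forall l q, L l -> Q q -> Q (l * q)%g.

Let K_sat : saturated K.
Proof.
move=> l g Ll [k Lk Ck]; exists (l * k)%g; first exact: LM.
by rewrite invgM -mulgA mulKg.
Qed.

(** Here K is L C0, and the trace of Q on the intersection of F and K is relatively open and closed.
    Modulo L these sets stand in for the clopen neighbourhoods of 1, while being open in G. *)
Let isolating (Q : set G) :=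
  [/\ open Q, Q 1%g, saturated Q & closure Q `&` (F `&` K) `<=` Q].

Let isolatingT : isolating setT.
Proof. by split => //; exact: openT. Qed.

Let isolatingI Q Q' : isolating Q -> isolating Q' -> isolating (Q `&` Q').
Proof.
move=> [oQ Q1 sQ cQ] [oQ' Q'1 sQ' cQ']; split.
- exact: openI.
- by split.
- by move=> l q Ll [Qq Q'q]; split; [exact: sQ|exact: sQ'].
- by move=> g [/closureI[clQ clQ'] FKg]; split; [exact: cQ|exact: cQ'].
Qed.

(* The preimage of the quasi-component of 1 in (F `&` K) / L. Working with
   saturated subsets of G avoids the quotient. *)
Let Qc : set G := [set g | F g /\ K g /\ forall Q, isolating Q -> Q g].

Let C0K : C0 `<=` K.
Proof. by move=> c Cc; exists 1%g => //; rewrite invg1 mul1g. Qed.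

Let C0_closed : closed C0.
Proof. by apply: compact_closed => //; exact: manifold_hausdorff. Qed.

(** Otherwise the isolating sets, stable under intersection, have a cluster point in the compact
    part of F and C0 outside U. The closure condition puts that point in every isolating set, hence
    in [Qc], hence in U. *)
Let isolating_sub (U : set G) : open U -> Qc `&` C0 `<=` U ->
  exists2 Q, isolating Q & Q `&` (F `&` C0) `<=` U.
Proof.
move=> oU QcU; apply: contrapT => noQ.
pose Z := (C0 `&` F) `&` ~` U.
have Zc : compact Z.
  apply: compact_closedI; first exact: compact_closedI.
  by rewrite closedC.
pose FF := filter_from isolating (fun Q => Q `&` Z).
have FF_filter : ProperFilter FF.
  apply: filter_from_proper.
    apply: filter_from_filter; first by exists setT.
    move=> Q Q' iQ iQ'; exists (Q `&` Q'); first exact: isolatingI.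
    by move=> g [[? ?] ?].
  move=> Q iQ; apply: contrapT => /set0P/negP/negPn/eqP QZ0; apply: noQ.
  exists Q => // g [Qg [Fg Cg]]; apply: contrapT => nUg.
  by have : (Q `&` Z) g by []; rewrite QZ0.
have FFZ : FF Z by exists setT => // g [].
have [x [[[Cx Fx] nUx] clx]] := Zc _ FF_filter FFZ.
apply: nUx; apply: QcU; split => //; split => //; split; first exact: C0K.
move=> Q iQ; have [_ _ _ cQ] := iQ; apply: cQ; split; last by split => //; exact: C0K.
have FFQ : FF Q by exists Q => // g [].
by move=> B /(clx _ _ FFQ).
Qed.

Let Qc_sat : saturated Qc.
Proof.
move=> l g Ll [Fg [Kg Qg]]; split; first by apply: FM => //; exact: LF.
split; first exact: K_sat.
by move=> Q iQ; have [_ _ sQ _] := iQ; apply: sQ => //; exact: Qg.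
Qed.

Let Qc1 : Qc 1%g.
Proof.
split => //; split; first by apply: C0K; exact: nbhs_singleton.
by move=> Q [].
Qed.

Let Qc_C0_closed : closed (Qc `&` C0).
Proof.
have -> : Qc `&` C0 = (F `&` C0) `&` \bigcap_(Q in isolating) closure Q.
  apply/seteqP; split => g.
    move=> [[Fg [Kg Qg]] Cg]; split => // Q iQ.
    by apply: subset_closure; exact: Qg.
  move=> [[Fg Cg] Qg]; split => //; split => //; split; first exact: C0K.
  move=> Q iQ; have [_ _ _ cQ] := iQ; apply: cQ; split; first exact: Qg.
  by split => //; exact: C0K.
apply: closedI; first exact: closedI.
by apply: closed_bigI => Q _; exact: closed_closure.
Qed.

(** The coset L a of a point a of [Qc] is connected and stays in [Qc], so a separation cannot split
    it. *)
Let sat_part (A B : set G) : separated A B -> Qc = A `|` B -> saturated A.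
Proof.
move=> sAB QAB l a Ll Aa.
have : [set (k * a)%g | k in L] `<=` A `|` B.
  move=> _ [k Lk <-]; rewrite -QAB; apply: Qc_sat => //.
  by rewrite QAB; left.
have cLa : connected [set (k * a)%g | k in L].
  apply: (connected_continuous_connected (f := fun k => (k * a)%g)).
    exact: component_connected.
  apply: continuous_subspaceT => k; apply: mulg_continuous_at.
    by move=> ?; exact: cvg_id.
  exact: cst_continuous.
move=> /(connected_subset sAB)/(_ cLa)[LaA|LaB].
  by apply: LaA; exists l.
have Ba : B a by apply: LaB; exists 1%g => //; rewrite mul1g.
by have [+ _] := sAB => /seteqP[/(_ a)]; case; split => //; exact: subset_closure.
Qed.

(** The two pieces get disjoint saturated open neighbourhoods A N and B N. Some isolating Q meets F
    and C0 only inside their union, and Q cut down to A N is still isolating; a point of B would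
    then lie in both neighbourhoods. *)
Let Qc_part (A B : set G) : separated A B -> Qc = A `|` B -> A 1%g -> B = set0.
Proof.
move=> sAB QAB A1.
have sA : saturated A by exact: sat_part sAB QAB.
have sB : saturated B.
  apply: (@sat_part B A); last by rewrite setUC.
  by have [h1 h2] := sAB; split; rewrite setIC.
have AB g : B g -> ~ closure A g.
  by move=> Bg cAg; have [+ _] := sAB => /seteqP[/(_ g)]; case.
have BA g : closure B g -> ~ A g.
  by move=> cBg Ag; have [_ +] := sAB => /seteqP[/(_ g)]; case.
have BC0c : compact (B `&` C0).
  apply: (subclosed_compact _ C0c); last by move=> g [].
  have -> : B `&` C0 = (Qc `&` C0) `&` closure B.
    apply/seteqP; split => g.
      by move=> [Bg Cg]; split; [split => //; rewrite QAB; right|exact: subset_closure].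
    move=> [[+ Cg] cBg]; rewrite QAB => -[Ag|//].
    by have := BA _ cBg.
  by apply: closedI => //; exact: closed_closure.
(* By compactness one neighbourhood of 1 serves all b in B and C0: b n1 n2^-1 stays outside A. *)
have : \forall z \near (1%g, 1%g) : G * G,
    B `&` C0 `<=` [set b | ~ A (b * (z.1 * z.2^-1))%g].
  move/compact_near_coveringP : BC0c => /(_ (G * G)%type (nbhs (1%g, 1%g))
    (fun z b => ~ A (b * (z.1 * z.2^-1))%g)); apply => b [Bb _].
  have nA : nbhs (b * (1 * 1^-1))%g (~` closure A).
    rewrite invg1 !mulg1; apply: open_nbhs_nbhs; split; last exact: AB.
    by rewrite openC; exact: closed_closure.
  have cont : {for (b, (1%g, 1%g)), continuous
      (fun w : G * (G * G) => (w.1 * (w.2.1 * w.2.2^-1))%g)}.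
    apply: mulg_continuous_at; first exact: cvg_fst.
    apply: mulg_continuous_at.
      by apply: (@cvg_comp _ _ _ snd fst); [exact: cvg_snd|exact: cvg_fst].
    apply: invg_continuous_at.
    by apply: (@cvg_comp _ _ _ snd snd); exact: cvg_snd.
  have : \forall w \near (b, (1%g, 1%g)),
    ~ closure A (w.1 * (w.2.1 * w.2.2^-1))%g by exact: cont _ nA.
  by apply: filterS => w nAw Aw; apply: nAw; exact: subset_closure.
move=> [[N1 N2] /= [N1n N2n] NAB].
pose N := (N1 `&` N2)°.
have oN : open N by exact: open_interior.
have N_1 : N 1%g by exact: filterI.
pose UA := [set g | exists2 a, A a & N (a^-1 * g)%g].
pose UB := [set g | exists2 b, B b & N (b^-1 * g)%g].
(* At a common point g, a = b (b^-1 g) (a^-1 g)^-1. Multiplication by l^-1 on the left brings b into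
   C0 and keeps a and b in their pieces. *)
have UAB g : UA g -> UB g -> False.
  move=> [a Aa Nag] [b Bb Nbg].
  have [Fb [[l Ll Clb] _]] : Qc b by rewrite QAB; right.
  have /NAB /= : (N1 `*` N2) (b^-1 * g, a^-1 * g)%g.
    by split; [have [] := interior_subset Nbg|have [] := interior_subset Nag].
  move=> /(_ (l^-1 * b)%g) []; first by split => //; apply: sB => //; exact: LV.
  rewrite invgM invgK -!mulgA mulVKg mulVKg; apply: sA => //; exact: LV.
have oUA : open UA by exact: open_right_translates.
have oUB : open UB by exact: open_right_translates.
have AUA : A `<=` UA by move=> a Aa; exists a => //; rewrite mulVg.
have BUB : B `<=` UB by move=> a Aa; exists a => //; rewrite mulVg.
have sUA : saturated UA.
  move=> l g Ll [a Aa Nag]; exists (l * a)%g; first exact: sA.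
  by rewrite invgM -mulgA mulKg.
have sUB : saturated UB.
  move=> l g Ll [a Aa Nag]; exists (l * a)%g; first exact: sB.
  by rewrite invgM -mulgA mulKg.
have [] := @isolating_sub (UA `|` UB); first exact: openU.
  by rewrite QAB => g [[Ag|Bg] _]; [left; exact: AUA|right; exact: BUB].
move=> Q [oQ Q1 sQ cQ] QU.
(* A point of F and K in the closure lies in [UA] or in [UB], by saturation; the open set [UB] is
   disjoint from [UA], so it contains no point of the closure. *)
have iQ' : isolating (Q `&` UA).
  split; first exact: openI.
  - by split => //; exact: AUA.
  - by move=> l g Ll [Qg Ug]; split; [exact: sQ|exact: sUA].
  - move=> g [clg [Fg Kg]].
    have Qg : Q g by apply: cQ; split => //; have [] := closureI clg.
    split => //; have [l Ll Clg] := Kg.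
    have : (UA `|` UB) (l^-1 * g)%g.
      apply: QU; split; first by apply: sQ => //; exact: LV.
      by split => //; apply: FM => //; apply: LF; exact: LV.
    move=> [UAg|UBg]; first by rewrite -(mulVKg l g); exact: sUA.
    have : nbhs g UB.
      by apply: open_nbhs_nbhs; split => //; rewrite -(mulVKg l g); exact: sUB.
    by move=> /clg[h [[_ UAh] /(UAB _ UAh)]].
rewrite -subset0 => b Bb.
have [_ [_ /(_ _ iQ')[_ UAb]]] : Qc b by rewrite QAB; right.
exact: UAB UAb (BUB _ Bb).
Qed.

(** By [Qc_part] no separation of [Qc] has two nonempty pieces, so [Qc] is a connected subset of F
    through 1. *)
Let Qc_sub : Qc `<=` L.
Proof.
apply: connected_component_max => //; first by move=> g [].
apply: contrapT => /connectedPn[E [E0 QE sE]].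
have : Qc 1%g by []; rewrite QE => -[E1|E1].
  by have := E0 true; rewrite (Qc_part sE QE E1) => -[].
have sE' : separated (E true) (E false).
  by have [h1 h2] := sE; split; rewrite setIC.
have QE' : Qc = E true `|` E false by rewrite setUC.
by have := E0 false; rewrite (Qc_part sE' QE' E1) => -[].
Qed.

Lemma isolating_in_tube (O : set G) : nbhs 1%g O ->
  exists2 Q, isolating Q & Q `&` (F `&` C0) `<=`
     [set g | exists2 l, L l & O (l^-1 * g)%g].
Proof.
move=> On.
have [Q iQ QU] : exists2 Q, isolating Q & Q `&` (F `&` C0) `<=`
     [set g | exists2 l, L l & O° (l^-1 * g)%g].
  apply: isolating_sub; first by apply: open_right_translates; exact: open_interior.
  by move=> g [/Qc_sub Lg _]; exists g => //; rewrite mulVg.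
by exists Q => // g /QU[l Ll /interior_subset Og]; exists l.
Qed.

End Saturation.

(** The closure condition is freed from K by intersecting with a thin tube L O'. As O' lies in W and
    W W' in C0, the closure of the tube lies in L C0, where the condition on isolating sets
    applies. *)
Lemma isolating_exists (O : set G) : nbhs 1%g O ->
  exists Q : set G, [/\ open Q, Q 1%g, forall l q, L l -> Q q -> Q (l * q)%g,
    Q `<=` [set g | exists2 l, L l & O (l^-1 * g)%g] & closure Q `&` F `<=` Q].
Proof.
move=> On; have [C0 C0n C0c] := manifold_locally_compact (1%g : G).
have : \forall z \near ((1%g, 1%g) : G * G), C0 (z.1 * z.2)%g.
  by apply: (@lie_mul_continuous _ _ G (1%g, 1%g)); rewrite /= mulg1.
move=> [[W W'] /= [Wn W'n] WC0].
pose O' := (O `&` W)°.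
have O'n : nbhs 1%g O' by apply: nbhs_interior; exact: filterI.
have [Q [oQ Q1 sQ cQ] QO'] := isolating_in_tube C0n C0c O'n.
pose LO' := [set g | exists2 l, L l & O' (l^-1 * g)%g].
have oLO' : open LO' by apply: open_right_translates; exact: open_interior.
have sLO' l g : L l -> LO' g -> LO' (l * g)%g.
  move=> Ll [k Lk Okg]; exists (l * k)%g; first exact: LM.
  by rewrite invgM -mulgA mulKg.
exists (Q `&` LO'); split.
- exact: openI.
- by split => //; exists 1%g => //; rewrite invg1 mulg1; exact: nbhs_singleton.
- by move=> l q Ll [Qq Oq]; split; [exact: sQ|exact: sLO'].
- by move=> g [_ [l Ll /interior_subset[Og _]]]; exists l.
move=> g [/closureI[clQ clO'] Fg].
have : nbhs g [set h | W' (h^-1 * g)%g].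
  have cont : {for g, continuous (fun h => (h^-1 * g)%g)}.
    apply: mulg_continuous_at; last exact: cst_continuous.
    exact: lie_inv_continuous.
  by apply: cont; rewrite mulVg.
move=> /clO'[h [[l Ll /interior_subset[_ Wlh]] W'hg]].
have Clg : C0 (l^-1 * g)%g.
  have /WC0 : (W `*` W') (l^-1 * h, h^-1 * g)%g by [].
  by rewrite /= -mulgA mulVKg.
have Qg : Q g by apply: cQ; split => //; split => //; exists l.
(* The point l^-1 g lies in Q, F and C0 together, hence in the tube, which is saturated. *)
split => //; rewrite -(mulVKg l g); apply: sLO' => //; apply: QO'; split.
  by apply: sQ => //; exact: LV.
by split => //; apply: FM => //; apply: LF; exact: LV.
Qed.

End QuasiComponent.

(** * Free and proper actions *)

Lemma hausdorff_near_neq (T : topologicalType) (a b : T) :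
  hausdorff_space T -> a <> b -> \forall z \near (a, b), z.1 <> z.2.
Proof.
rewrite open_hausdorff => hT /eqP/hT[[A B] /= [/set_mem Aa /set_mem Bb]].
move=> [oA oB /eqP AB0]; exists (A, B) => /=.
  by split; apply: open_nbhs_nbhs.
move=> [x y] /= [Ax By] xy; have : (A `&` B) x by split; rewrite // xy.
by rewrite AB0.
Qed.

Section ProperAction.
Context {R : realType} {m n : nat} {G : lieGroupType R m} {P : manifoldType R n}.
Context {act : G -> P -> P}.
Hypotheses (act_smooth : smooth_action act) (act_free : free_action act)
  (act_proper : proper_action act).

Let act1 p : act 1%g p = p. Proof. by have [] := act_smooth. Qed.
Let actM g h p : act (g * h)%g p = act g (act h p).
Proof. by have [] := act_smooth. Qed.

Lemma smooth_action_continuous : continuous (fun z : G * P => act z.1 z.2).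
Proof. by have [_ _ []] := act_smooth. Qed.

Lemma act_continuous_at (T : topologicalType) (u : T -> G) (v : T -> P) (x : T) :
  {for x, continuous u} -> {for x, continuous v} ->
  {for x, continuous (fun y => act (u y) (v y))}.
Proof.
move=> cu cv; apply: continuous2_cvg => //.
exact: (@smooth_action_continuous (u x, v x)).
Qed.

Lemma act_continuousr g : continuous (act g).
Proof.
by move=> p; apply: act_continuous_at; [exact: cst_continuous|move=> ?; exact: cvg_id].
Qed.

Lemma act_continuousl p : continuous (act ^~ p).
Proof.
by move=> g; apply: act_continuous_at; [move=> ?; exact: cvg_id|exact: cst_continuous].
Qed.

Lemma actK g : cancel (act g) (act g^-1%g).
Proof. by move=> p; rewrite -actM mulVg act1. Qed.

Lemma actVK g : cancel (act g^-1%g) (act g).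
Proof. by move=> p; rewrite -actM mulgV act1. Qed.

Lemma open_translates (A : set G) (U : set P) : open U ->
  open [set act g u | g in A & u in U].
Proof.
move=> oU; rewrite openE => _ [g Ag [u Uu <-]].
have : \forall p \near act g u, U (act (g^-1)%g p).
  have := @act_continuousr (g^-1)%g (act g u).
  by apply; rewrite actK; apply: open_nbhs_nbhs.
by apply: filterS => p Up; exists g => //; exists (act (g^-1)%g p); rewrite ?actVK.
Qed.

(** By properness the pairs (g, q) with q and g q in K and g outside the interior of O form a
    compact set. By freeness none of them has (g q, q) = (p, p), so a whole neighbourhood of (p, p)
    is avoided. *)
Lemma free_proper_small_returns (p : P) (O : set G) : nbhs 1%g O ->
  exists2 U : set P, nbhs p U & forall g u, U u -> U (act g u) -> O g.
Proof.
move=> On; have [K Kn Kc] := manifold_locally_compact p.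
have hP : hausdorff_space P := manifold_hausdorff.
pose S := [set z : G * P | (K `*` K) (act z.1 z.2, z.2)] `&`
  ~` (fst @^-1` O°).
have Sc : compact S.
  apply: compact_closedI; first exact/act_proper/compact_setX.
  rewrite closedC; apply: open_comp; last exact: open_interior.
  by move=> z _; exact: cvg_fst.
have : \forall w \near (p, p), S `<=` [set z | ~ (act z.1 z.2 = w.1 /\ z.2 = w.2)].
  move/compact_near_coveringP : Sc => /(_ (P * P)%type (nbhs (p, p))
    (fun w z => ~ (act z.1 z.2 = w.1 /\ z.2 = w.2))); apply => -[g q] [_ /= nOg].
  have [qp|qp] := pselect (q = p).
    have gp : act g q <> p.
      rewrite qp => gpp; apply: nOg; rewrite (act_free gpp).
      exact: nbhs_singleton (nbhs_interior On).
    have cont : {for ((g, q), (p, p)), continuous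
      (fun w : (G * P) * (P * P) => (act w.1.1 w.1.2, w.2.1))}.
      apply: cvg_pair; last by apply: (@cvg_comp _ _ _ snd fst); [exact: cvg_snd|exact: cvg_fst].
      apply: (act_continuous_at (x := ((g, q), (p, p)))
          (u := fun w => w.1.1) (v := fun w => w.1.2)).
        by apply: (@cvg_comp _ _ _ fst fst); exact: cvg_fst.
      by apply: (@cvg_comp _ _ _ fst snd); [exact: cvg_fst|exact: cvg_snd].
    have : \forall w \near ((g, q), (p, p)), act w.1.1 w.1.2 <> w.2.1.
      exact: cont (hausdorff_near_neq hP gp).
    by apply: filterS => w nw [].
  have cont : {for ((g, q), (p, p)), continuous
    (fun w : (G * P) * (P * P) => (w.1.2, w.2.2))}.
    apply: cvg_pair; last by apply: (@cvg_comp _ _ _ snd snd); exact: cvg_snd.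
    by apply: (@cvg_comp _ _ _ fst snd); [exact: cvg_fst|exact: cvg_snd].
  have : \forall w \near ((g, q), (p, p)), w.1.2 <> w.2.2.
    exact: cont (hausdorff_near_neq hP qp).
  by apply: filterS => w nw [].
move=> [[U1 U2] /= [U1n U2n] US].
exists ((U1 `&` U2) `&` K); first by apply: filterI => //; exact: filterI.
move=> g u [[_ U2u] Ku] [[U1gu _] Kgu].
apply: contrapT => nOg; have /US /(_ (g, u)) /= : (U1 `*` U2) (act g u, u) by [].
move=> /[dup] ?; apply; last by [].
by split => //= /interior_subset.
Qed.


(* f is a distance to the level of p that does not see the identity component L
   of the isotropy group F of that level. *)
Lemma confinement (f : P -> R) (p : P) (F : set G) (U : set P) :
  let L : set G := connected_component F 1%g in
  continuous f ->
  (forall g h, F g -> F h -> F (g * h)%g) -> (forall g, F g -> F (g^-1)%g) ->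
  (forall g, F g <-> f (act g p) = f p) ->
  (forall l q, L l -> f (act l q) = f q) ->
  nbhs p U ->
  exists2 U0 : set P, open_nbhs p U0 & forall x : R -> P, continuous x ->
    U0 (x 0) -> (forall t, f (x t) = f (x 0)) ->
    (forall t, [set act g u | g in [set: G] & u in U0] (x t)) ->
    forall t, [set act g u | g in L & u in U] (x t).
Proof.
move=> L cf FM FV FE fL Un.
have F1 : F 1%g by apply/FE; rewrite act1.
have clF : closed F.
  have -> : F = (fun g => f (act g p)) @^-1` [set f p].
    by apply/seteqP; split => g /FE.
  apply: closed_comp; last exact: closed_eq.
  by move=> g _; apply: continuous_comp; [exact: act_continuousl|exact: cf].
have LV l : L l -> L (l^-1)%g by exact: identity_componentV.
have [C0 C0n C0c] := manifold_locally_compact (1%g : G).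
have : \forall z \near ((1%g, p) : G * P), U (act z.1 z.2).
  by apply: (@smooth_action_continuous (1%g, p)); rewrite /= act1.
move=> [[N U1] /= [Nn U1n] NU].
have [Q [oQ Q1 sQ QN cQ]] : exists Q : set G, [/\ open Q, Q 1%g,
    forall l q, L l -> Q q -> Q (l * q)%g,
    Q `<=` [set g | exists2 l, L l & (N `&` C0) (l^-1 * g)%g]
    & closure Q `&` F `<=` Q].
  by apply: isolating_exists => //; exact: filterI.
(* Each point of Q has a translate under L in this compact set. *)
have Yc : compact (C0 `&` closure Q).
  by apply: compact_closedI => //; exact: closed_closure.
(* Uniformly in c, for h near 1 and q, q' near p, either c h is in Q or f (c h q) differs from f q'.
   For c in Q this is openness of Q; otherwise c is outside F and f (c p) differs from f p. The
   point q' will be x 0. *)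
have : \forall w \near ((1%g, (p, p)) : G * (P * P)), C0 `&` closure Q `<=`
    [set c | Q (c * w.1)%g \/ f (act (c * w.1)%g w.2.1) <> f w.2.2].
  move/compact_near_coveringP : Yc => /(_ _ (nbhs (1%g, (p, p)))
    (fun w c => Q (c * w.1)%g \/ f (act (c * w.1)%g w.2.1) <> f w.2.2)).
  apply => c [_ cQc].
  have cM : {for (c, (1%g, (p, p))), continuous
      (fun w : G * (G * (P * P)) => (w.1 * w.2.1)%g)}.
    apply: mulg_continuous_at; first exact: cvg_fst.
    by apply: (@cvg_comp _ _ _ snd fst); [exact: cvg_snd|exact: cvg_fst].
  have [Qc|nQc] := pselect (Q c).
    have : \forall w \near (c, (1%g, (p, p)) : G * (P * P)), Q (w.1 * w.2.1)%g.
      by apply: cM; rewrite /= mulg1; apply: open_nbhs_nbhs.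
    by apply: filterS => w; left.
  have fcp : f (act (c * 1)%g p) - f p != 0.
    rewrite mulg1 subr_eq0; apply/eqP => fcp; apply: nQc; apply: cQ.
    by split => //; exact/FE.
  have c22 : {for (c, (1%g, (p, p))), continuous
      (fun w : G * (G * (P * P)) => w.2.2)}.
    by apply: (@cvg_comp _ _ _ snd snd); exact: cvg_snd.
  have cf' : {for (c, (1%g, (p, p))), continuous (fun w : G * (G * (P * P)) =>
      f (act (w.1 * w.2.1)%g w.2.2.1) - f w.2.2.2)}.
    apply: continuousB; (apply: continuous_comp; last exact: cf).
      apply: (act_continuous_at (x := (c, (1%g, (p, p))))
        (u := fun w => (w.1 * w.2.1)%g) (v := fun w => w.2.2.1)) => //.
      by apply: (cvg_comp _ _ c22); exact: cvg_fst.
    by apply: (cvg_comp _ _ c22); exact: cvg_snd.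
  have : \forall w \near (c, (1%g, (p, p)) : G * (P * P)),
      f (act (w.1 * w.2.1)%g w.2.2.1) - f w.2.2.2 != 0.
    have nz : nbhs (f (act (c * 1)%g p) - f p) [set y : R | y != 0].
      by apply: open_nbhs_nbhs; split => //; exact: open_neq.
    exact: cf' nz.
  by apply: filterS => w; rewrite subr_eq0 => /eqP fw; right.
move=> [[N1 W] /= [N1n [[W1 W2] /= [W1n W2n] W12]] N1W].
have [V Vn VN1] := free_proper_small_returns p N1n.
pose U0 := ((U1 `&` V) `&` (W1 `&` W2))°.
have U0n : open_nbhs p U0.
  split; first exact: open_interior.
  by apply: filterI; exact: filterI.
have oU0 : open U0 by have [] := U0n.
exists U0 => // x cx x0 fx xG.
pose T1 := x @^-1` [set act g u | g in Q & u in U0].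
pose T2 := x @^-1` [set act g u | g in ~` Q & u in U0].
have oT1 : open T1.
  by apply: open_comp; [move=> ? _; exact: cx|exact: open_translates].
have oT2 : open T2.
  by apply: open_comp; [move=> ? _; exact: cx|exact: open_translates].
(* If q u = q' u' with q in Q and q' outside Q, then h = q^-1 q' sends u' to u and so is near 1. For
   c = l^-1 q in C0, the product c h = l^-1 q' is outside Q, so f (l^-1 q' u') differs from f (x 0).
   This contradicts the L-invariance of f and its constancy along x. *)
have T12 t : T1 t -> T2 t -> False.
  move=> [q Qq [u /interior_subset[[U1u Vu] [W1u W2u]] qu]].
  move=> [q' nQq' [u' /interior_subset[[U1u' Vu'] [W1u' W2u']] qu']].
  have [l Ll [Nlq Clq]] := QN _ Qq.
  pose h := (q^-1 * q')%g.
  have N1h : N1 h by apply: (VN1 h u') => //; rewrite /h actM qu' -qu actK.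
  have : (N1 `*` W) (h, (u', x 0)).
    split => //; apply: W12; split => //=.
    by have /interior_subset[_ []] := x0.
  move=> /N1W /= /(_ (l^-1 * q)%g)[].
  - by split => //; apply: subset_closure; apply: sQ => //; exact: LV.
  - rewrite /h -mulgA mulVKg => Qlq'; apply: nQq'.
    by rewrite -(mulVKg l q'); exact: sQ.
  - apply; rewrite /h -mulgA mulVKg actM fL; last exact: LV.
    by rewrite qu' fx.
have T12T t : T1 t \/ T2 t.
  have [g _ [u U0u gu]] := xG t.
  by have [Qg|nQg] := pselect (Q g); [left|right]; exists g => //; exists u.
have T1E : T1 = [set: R].
  have : connected [set: R] by apply/connected_intervalP.
  apply.
  - by exists 0; exists 1%g => //; exists (x 0) => //; rewrite act1.
  - by exists T1 => //; rewrite setTI.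
  - exists T1; last by rewrite setTI.
    have -> : T1 = ~` T2.
      apply/seteqP; split => t; first by move=> T1t; exact: T12.
      by case: (T12T t).
    by rewrite closedC.
move=> t; have : T1 t by rewrite T1E.
move=> [q Qq [u /interior_subset[[U1u _] _] <-]].
have [l Ll [Nlq _]] := QN _ Qq.
exists l => //; exists (act (l^-1 * q)%g u); last by rewrite -actM mulVKg.
exact: (NU (l^-1 * q, u)%g).
Qed.

End ProperAction.

(** * Conservation of the momentum *)

Section Differentials.
Context {R : realType}.

Lemma smooth_on_differentiable (V W : normedModType R) (U : set V) (f : V -> W)
  (x : V) : smooth_on U f -> U x -> differentiable f x.
Proof. by move=> /(_ 1%N) [df _] /df. Qed.

Lemma pairing_differentiable m (xi : 'rV[R]_m) (mu : 'cV[R]_m) :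
  differentiable (pairing ^~ xi) mu.
Proof.
have -> : pairing ^~ xi = \sum_(i < m) (fun nu : 'cV[R]_m => xi 0 i *: nu i 0).
  by apply/funext => nu; rewrite fct_sumE /pairing mxE.
apply: differentiable_sum => i.
apply: differentiableZ.
exact: differentiable_coord.
Qed.

Section ChainRule.
Context {n : nat} {M : manifoldType R n}.
Implicit Types (W : normedModType R).

Lemma smooth_fun_differentiable W (f : M -> W) (x : M) : smooth_fun f ->
  differentiable (f \o chart_inv (chart_at x : chart R n M)) (chart_at x x).
Proof.
move=> sf; apply: smooth_on_differentiable (sf _ (chart_at_atlas x)) _.
by exists x => //; exact: chart_at_dom.
Qed.

Lemma near_chart (T : topologicalType) (c : T -> M) (t : T) :
  {for t, continuous c} -> \forall s \near t,
    chart_inv (chart_at (c t) : chart R n M) (chart_at (c t) (c s)) = c s.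
Proof.
move=> ct.
have dn : nbhs (c t) (chart_dom (chart_at (c t) : chart R n M)).
  by apply: open_nbhs_nbhs; split; [exact: chart_dom_open|exact: chart_at_dom].
have : \forall s \near t, chart_dom (chart_at (c t) : chart R n M) (c s).
  exact: ct dn.
by apply: filterS => s; exact: chart_mapK.
Qed.

Lemma smooth_fun_continuous W (f : M -> W) : smooth_fun f -> continuous f.
Proof.
move=> sf x.
have cid : {for x, continuous (@id M)} by move=> ?.
have cc : {for x, continuous (chart_at x : M -> 'rV[R]_n)}.
  exact: chart_map_continuous (chart_at_dom x).
have : {for x, continuous ((f \o chart_inv (chart_at x)) \o chart_at x)}.
  apply: continuous_comp => //.
  exact/differentiable_continuous/smooth_fun_differentiable.
rewrite /prop_for /continuous_at /= chart_mapK; last exact: chart_at_dom.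
apply: cvg_trans; apply: near_eq_cvg.
by have := near_chart cid; apply: filterS => y /= ->.
Qed.

Lemma is_derive_along_curve W (f : M -> W) (c : R -> M) (t : R) (v : 'rV[R]_n) :
  differentiable (f \o chart_inv (chart_at (c t) : chart R n M))
    (chart_at (c t) (c t)) ->
  {for t, continuous c} -> is_derive t (1 : R) (chart_at (c t) \o c) v ->
  is_derive t (1 : R) (f \o c) (mdiff f (c t) v).
Proof.
move=> df ct dc.
have dct : differentiable (chart_at (c t) \o c) t.
  by apply/derivable1_diffP; exact: ex_derive.
apply: (near_eq_is_derive
    (f := (f \o chart_inv (chart_at (c t))) \o (chart_at (c t) \o c))).
  by have := near_chart ct; apply: filterS => s /= ->.
have dfc := differentiable_comp dct df.
apply: DeriveDef; first exact: diff_derivable.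
have dv : 'd (chart_at (c t) \o c) t 1 = v by rewrite -deriveE//; exact: derive_val.
by rewrite deriveE// diff_comp//= dv.
Qed.

End ChainRule.
End Differentials.

Section Noether.
Context {R : realType} {m n : nat} {G : lieGroupType R m} {P : manifoldType R n}.
Context {act : G -> P -> P} {omega : P -> {skew_symmetric 'rV[R]_n}}.
Hypothesis act_smooth : smooth_action act.

Let act1 p : act 1%g p = p. Proof. by have [] := act_smooth. Qed.

(** The infinitesimal action is the derivative at 1 of the orbit map g -> g x, along which H is
    constant. *)
Lemma mdiff_infinitesimal_action0 (H : P -> R) (x : P) (xi : 'rV[R]_m) :
  smooth_fun H -> (forall g p, H (act g p) = H p) ->
  mdiff H x (infinitesimal_action act xi x) = 0.
Proof.
move=> sH Hinv.
pose e : chart R m G := chart_at 1%g.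
pose c : chart R n P := chart_at x.
have e1 : chart_dom e 1%g by exact: chart_at_dom.
have cx : chart_dom c x by exact: chart_at_dom.
have eK : chart_inv e (e 1%g) = 1%g by exact: chart_mapK.
have cK : chart_inv c (c x) = x by exact: chart_mapK.
pose a : 'rV[R]_m -> 'rV[R]_n := c \o act ^~ x \o chart_inv e.
have ae : a (e 1%g) = c x by rewrite /a /= eK act1.
have da : differentiable a (e 1%g).
  (* Smoothness of the action is joint, so the orbit map is written as its restriction to the slice
     through c x. *)
  have -> : a = (fun y => c (act (chart_inv e y.1) (chart_inv c y.2))) \o
      (fun y => (y, c x)) by apply/funext => y; rewrite /a /= cK.
  apply: differentiable_comp.
    by apply: differentiable_pair => //; exact: differentiable_cst.
  have [_ _ [_ /(_ e c c)]] := act_smooth.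
  move=> /(_ (chart_at_atlas _) (chart_at_atlas _) (chart_at_atlas _)) sa.
  apply: smooth_on_differentiable sa _ => /=.
  by split; [exists 1%g|exists x|rewrite eK cK act1].
have dH : differentiable (H \o chart_inv c) (a (e 1%g)).
  by rewrite ae; exact: smooth_fun_differentiable.
have -> : mdiff H x (infinitesimal_action act xi x) =
    'd ((H \o chart_inv c) \o a) (e 1%g) xi.
  by rewrite (diff_comp da dH) ae /infinitesimal_action /mderiv act1.
rewrite -deriveE; last exact: differentiable_comp.
have <- : 'D_xi (cst (H x)) (e 1%g) = 0 :> R.
  by rewrite deriveE ?diff_cst//; exact: differentiable_cst.
apply: near_eq_derive.
have cont : {for e 1%g, continuous (fun y => act (chart_inv e y) x)}.
  apply: (continuous_comp (f := chart_inv e) (g := act ^~ x)); last first.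
    exact: (act_continuousl act_smooth).
  have e1_img : (e @` chart_dom e) (e 1%g) by exists 1%g.
  exact: chart_inv_continuous e1_img.
have := near_chart cont; rewrite eK act1; apply: filterS => y ycK.
by rewrite /= ycK Hinv.
Qed.

(** With xi_P the infinitesimal action of xi, the derivative of the xi-component of J along c is
    omega (xi_P, X) = - omega (X, xi_P) = - dH (xi_P), which vanishes by invariance of H. *)
Lemma noether (J : P -> 'cV[R]_m) (H : P -> R) (X : P -> 'rV[R]_n)
    (c : R -> P) :
  momentum_map omega act J -> smooth_fun H ->
  (forall g p, H (act g p) = H p) -> hamiltonian_vector_field omega H X ->
  integral_curve_on X [set: R] c -> forall t, J (c t) = J (c 0).
Proof.
move=> [sJ mJ] sH Hinv hX icX t.
have pairJ xi : pairing (J (c t)) xi = pairing (J (c 0)) xi.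
  apply: (is_derive_0_is_cst (f := fun s => pairing (J (c s)) xi)) => s.
  have [cs dcs] := icX s Logic.I.
  apply: (is_derive_eq (f' := mdiff (fun p => pairing (J p) xi) (c s) (X (c s)))).
    apply: (is_derive_along_curve (f := fun p => pairing (J p) xi)) => //.
    have dJ := smooth_fun_differentiable (c s) sJ.
    exact: (differentiable_comp dJ (pairing_differentiable xi _)).
  rewrite -mJ hermC expr1 mulN1r /= hX mdiff_infinitesimal_action0//.
  exact: oppr0.
apply/matrixP => i j; rewrite ord1.
have := pairJ (delta_mx 0 i).
by rewrite /pairing -!rowE !mxE.
Qed.

End Noether.

(** * Continuity of the inner product, and the stability theorem *)

Lemma linear_cV_differentiable (R : realType) (m : nat)
    (g : {linear 'cV[R]_m -> R}) (v : 'cV[R]_m) : differentiable g v.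
Proof.
have -> : (g : 'cV[R]_m -> R) = pairing ^~ (\row_i g (delta_mx i 0)).
  apply/funext => w; rewrite [in LHS](matrix_sum_delta w) linear_sum /pairing mxE.
  by apply: eq_bigr => i _; rewrite big_ord1 linearZ mxE mulrC.
exact: pairing_differentiable.
Qed.

(** The topology comes from the matrix norm, not from [B]. Expanding one argument in the standard
    basis leaves products of coordinates with linear forms. *)
Lemma dot_cV_continuous (R : realType) (m : nat)
    (B : {dot 'cV[R]_m for (@idfun R)}) : continuous (fun v => B v v).
Proof.
have -> : (fun v => B v v) =
    \sum_(i < m) ((fun v : 'cV[R]_m => v i 0 : R) * B (delta_mx i 0)).
  apply/funext => v; rewrite fct_sumE [in LHS](matrix_sum_delta v) linear_sumlz.
  by apply: eq_bigr => i _; rewrite big_ord1 linearZl_LR -matrix_sum_delta.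
move=> v; apply: differentiable_continuous; apply: differentiable_sum => i.
apply: differentiableM; first exact: differentiable_coord.
exact: linear_cV_differentiable.
Qed.

Theorem corollary5p4 (R : realType) (m n : nat)
    (G : lieGroupType R m) (P : manifoldType R n)
    (omega : P -> {skew_symmetric 'rV[R]_n}) (act : G -> P -> P)
    (J : P -> 'cV[R]_m) (H : P -> R) (X : P -> 'rV[R]_n)
    (D : P -> set R) (Phi : R -> P -> P) (pe : P) :
  symplectic_form omega ->
  smooth_action act -> free_action act -> proper_action act ->
  symplectic_action omega act ->
  momentum_map omega act J -> equivariant_momentum act J ->
  smooth_fun H -> (forall g p, H (act g p) = H p) ->
  hamiltonian_vector_field omega H X ->
  maximal_flow X D Phi ->
  relative_equilibrium act X pe ->
  G_stable act D Phi pe ->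
  (exists B : {dot 'cV[R]_m for (@idfun R)},
      invariant_inner_product (isotropy0 (J pe) : set G) B) ->
  subset_stable act (isotropy0 (J pe)) D Phi pe.
Proof.
move=> _ act_smooth act_free act_proper _ mJ eqJ sH Hinv hX flow _ Gst [B invB].
move=> U oU Upe.
have [act1 actM _] := act_smooth.
pose mu := J pe.
pose f p := B (J p - mu) (J p - mu).
have f0 : f pe = 0 by rewrite /f subrr linear0l.
(* Equivariance gives [coadjoint g mu] = J (g pe), so the composition law is inherited from
   [act]. *)
have FM (g h : G) : isotropy mu g -> isotropy mu h -> isotropy mu (g * h)%g.
  by rewrite /isotropy /= -!eqJ actM => gmu hmu; rewrite eqJ hmu -eqJ.
have FV (g : G) : isotropy mu g -> isotropy mu (g^-1)%g.
  rewrite /isotropy /= => gmu.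
  by rewrite -[in LHS]gmu -!eqJ -actM mulVg act1.
(* Positive definiteness: f vanishes exactly on the level set of mu. *)
have FE (g : G) : isotropy mu g <-> f (act g pe) = f pe.
  rewrite f0 /f eqJ /isotropy /=; split => [->|fg0].
    by rewrite subrr linear0l.
  have [/eqP|nz] := eqVneq (coadjoint g mu - mu) 0.
    by rewrite subr_eq0 => /eqP.
  by have := @neq0_dnorm_gt0 _ _ _ B _ nz; rewrite fg0 ltxx.
(* Since l fixes mu, J (l q) - mu is the coadjoint image under l of J q - mu. *)
have fL (l : G) (q : P) : isotropy0 mu l -> f (act l q) = f q.
  move=> Ll; rewrite /f eqJ -[X in _ - X](connected_component_sub Ll).
  by rewrite /coadjoint /Ad_dual -mulmxBr; exact: invB.
have cf : continuous f.
  move=> p; apply: (continuous_comp (f := fun q => J q - mu) (g := fun v => B v v)).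
    apply: continuousB; last exact: cst_continuous.
    by apply: smooth_fun_continuous; have [] := mJ.
  exact: dot_cV_continuous.
have Un : nbhs pe U by exact: open_nbhs_nbhs.
have [U0 [oU0 U0pe] U0P] :=
  confinement act_smooth act_free act_proper cf FM FV FE fL Un.
(* The G-saturation of [U0] is the invariant neighbourhood to which G-stability is applied. *)
pose GU0 := [set act g u | g in [set: G] & u in U0].
have U0GU0 : U0 `<=` GU0 by move=> u U0u; exists 1%g => //; exists u.
have GU0n : nbhs pe GU0 by apply: filterS U0GU0 _; exact: open_nbhs_nbhs.
have GU0inv g p : GU0 p -> GU0 (act g p).
  by move=> [h _ [u U0u <-]]; exists (g * h)%g => //; exists u.
have [V Vn VP] := Gst _ GU0n GU0inv.
exists (V° `&` U0); split.
- by apply: openI => //; exact: open_interior.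
- by split.
move=> p [/interior_subset Vp U0p] t; have Dp s := (VP p Vp s).1.
split; first exact: Dp.
have [_ [Phi0 icPhi _]] := flow p.
have icT : integral_curve_on X [set: R] (Phi ^~ p).
  by move=> s _; apply: icPhi; exact: Dp.
apply: (U0P (Phi ^~ p)) => //.
- by move=> s; have [] := icT s Logic.I.
- by rewrite Phi0.
- by move=> s; rewrite /f (noether act_smooth mJ sH Hinv hX icT).
- by move=> s; have [] := VP p Vp s.
Qed.
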